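(* For each $n=1,2,\dots$, let $m_n\ge 1$ be an integer and let $K_n$ be an irreducible birth and death chain on $\Omega_n=\{0,1,\dots,m_n\}$ with stationary probability measure $\nu_n$. For $t\ge0$ let $\gamma_n^t$ be the distribution at time $t$ of the associated continuous-time process started at $0$. Let $0=\lambda_{n,0}<\lambda_{n,1}\le\cdots\le\lambda_{n,m_n}\le 2$ be the eigenvalues of $I-K_n$, and set $$\lambda_n=\lambda_{n,1},\qquad t_n=\sum_{i=1}^{m_n}\lambda_{n,i}^{-1},\qquad N_n=\lambda_n t_n .$$ For $\varepsilon\in(0,1)$ let $\tau_n(\varepsilon)=\inf\{t:\mathrm{sep}(\gamma_n^t,\nu_n)\le\varepsilon\}$. Then: (i) The family $(\Omega_n,\nu_n,(\gamma_n^t)_{t>0})_{n=1,2,\dots}$ has a separation cut-off if and only if $N_n=\lambda_n t_n$ tends to infinity. (ii) For any $n$ and any $c>0$, $$\mathrm{sep}(\gamma_n^{(1+c)t_n},\nu_n)\le\frac{1}{1+c^2N_n},$$ and (for $c\le 1$, so that the time $(1-c)t_n$ is nonnegative) $$\mathrm{sep}(\gamma_n^{(1-c)t_n},\nu_n)\ge 1-\frac{1}{1+c^2N_n}.$$ (iii) For any fixed $\varepsilon\in(0,1)$, the condition $\lambda_n t_n\to\infty$ is equivalent to $\lambda_n\tau_n(\varepsilon)\to\infty$.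
   Context: A birth and death chain on $\{0,1,\dots,m\}$ is a Markov kernel $K$ (a stochastic matrix) on this set with $K(x,y)=0$ unless $|x-y|\le 1$. It is irreducible when $K(x,x-1)>0$ for $0<x\le m$ and $K(x,x+1)>0$ for $0\le x<m$. It then has a unique stationary probability $\nu$, which is positive, and $K$ is reversible with respect to $\nu$, so $I-K$ is diagonalizable with real eigenvalues in $[0,2]$. The distribution at time $t\ge 0$ of the associated continuous-time process started at $0$ is $\gamma^t=e^{-t}\sum_{k=0}^\infty\frac{t^k}{k!}K^k(0,\cdot)$. For probability measures $\mu,\nu$ on a finite set $\Omega$ with $\nu$ positive, the separation is $\mathrm{sep}(\mu,\nu)=\max_{x\in\Omega}\{1-\mu(x)/\nu(x)\}$. Separation cut-off (continuous time): a family $(\Omega_n,\nu_n,(\gamma_n^t)_{t>0})_{n=1,2,\dots}$ has a separation cut-off if there exists a sequence $(s_n)$ of positive reals such that for any $\varepsilon\in(0,1)$: (a) $\lim_{n\to\infty}\mathrm{sep}(\gamma_n^{u_n},\nu_n)=0$ whenever $u_n>(1+\varepsilon)s_n$ for all sufficiently large $n$; and (b) $\lim_{n\to\infty}\mathrm{sep}(\gamma_n^{u_n},\nu_n)=1$ whenever $0\le u_n<(1-\varepsilon)s_n$ for all sufficiently large $n$. The sequence $(s_n)$ is not required to tend to infinity. *)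

(* Defs.v *)
From HB Require Import structures.
From mathcomp Require Import all_boot all_order all_algebra.
From mathcomp Require Import all_classical all_reals all_analysis.

Set Implicit Arguments.
Unset Strict Implicit.
Unset Printing Implicit Defensive.

Import Order.TTheory GRing.Theory Num.Theory.
Import numFieldNormedType.Exports.

Local Open Scope classical_set_scope.
Local Open Scope ring_scope.

(* Measures on {0, ..., m} are row vectors 'rV[R]_m.+1 and kernels are square
   matrices acting on them from the right. *)

Definition is_prob (R : realType) (m : nat) (mu : 'rV[R]_m.+1) : Prop :=
  (forall x, 0 <= mu 0 x) /\ \sum_x mu 0 x = 1.

Definition is_markov (R : realType) (m : nat) (K : 'M[R]_m.+1) : Prop :=
  forall x, is_prob (row x K).

Definition is_birth_death (R : realType) (m : nat) (K : 'M[R]_m.+1) : Prop :=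
  is_markov K /\
  (forall x y : 'I_m.+1, ((x.+1 < y) || (y.+1 < x))%N -> K x y = 0).

Definition bd_irreducible (R : realType) (m : nat) (K : 'M[R]_m.+1) : Prop :=
  (forall x y : 'I_m.+1, x = y.+1 :> nat -> 0 < K x y) /\
  (forall x y : 'I_m.+1, y = x.+1 :> nat -> 0 < K x y).

Definition is_stationary (R : realType) (m : nat) (K : 'M[R]_m.+1)
    (nu : 'rV[R]_m.+1) : Prop :=
  is_prob nu /\ nu *m K = nu.

Definition ct_law (R : realType) (m : nat) (K : 'M[R]_m.+1) (t : R) :
    'rV[R]_m.+1 :=
  \row_x (expR (- t) *
          limn (series (fun k => t ^+ k / k`!%:R * (K ^+ k) ord0 x))).

(* The seed of the iterated maximum is one of its terms, so this is the maximum
   over {0, ..., m} itself. *)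
Definition sep (R : realType) (m : nat) (mu nu : 'rV[R]_m.+1) : R :=
  \big[Num.max/1 - mu 0 ord0 / nu 0 ord0]_x (1 - mu 0 x / nu 0 x).

Definition has_sep_cutoff (R : realType) (m : nat -> nat)
    (nu : forall n, 'rV[R]_(m n).+1)
    (gamma : forall n, R -> 'rV[R]_(m n).+1) : Prop :=
  exists s : nat -> R, (forall n, 0 < s n) /\
    forall eps : R, 0 < eps < 1 ->
      (forall u : nat -> R,
         (\forall n \near \oo, (1 + eps) * s n < u n) ->
         sep (gamma n (u n)) (nu n) @[n --> \oo] --> (0 : R)) /\
      (forall u : nat -> R,
         (\forall n \near \oo, 0 <= u n < (1 - eps) * s n) ->
         sep (gamma n (u n)) (nu n) @[n --> \oo] --> (1 : R)).

(* lam 0 <= ... <= lam (d - 1) lists the eigenvalues of A with multiplicity;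
   the values lam i for i >= d are irrelevant. *)
Definition ordered_eigenvalues (R : realType) (d : nat) (A : 'M[R]_d)
    (lam : nat -> R) : Prop :=
  (forall i j, (i <= j < d)%N -> lam i <= lam j) /\
  char_poly A = \prod_(i < d) ('X - (lam i)%:P).

Definition sep_time (R : realType) (m : nat) (gamma : R -> 'rV[R]_m.+1)
    (nu : 'rV[R]_m.+1) (eps : R) : R :=
  inf [set t : R | 0 <= t /\ sep (gamma t) nu <= eps].

(* Main.v *)
Require Import Defs.
From HB Require Import structures.
From mathcomp Require Import all_boot all_order all_algebra.
From mathcomp Require Import all_classical all_reals all_analysis.
From mathcomp Require Import ring lra.

Set Implicit Arguments.
Unset Strict Implicit.
Unset Printing Implicit Defensive.

Import Order.TTheory GRing.Theory Num.Theory.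
Import numFieldNormedType.Exports.

Local Open Scope classical_set_scope.
Local Open Scope ring_scope.

(** Write L = I - K and let T be a sum of independent exponential variables
    with rates lam 1, ..., lam m, the nonzero eigenvalues of L.  Everything
    rests on the identity sep(gamma^t, nu) = P(T > t): since T has mean t_n and
    variance V = sum 1 / lam_i^2 <= t_n / lam 1, part (ii) is the one-sided
    Chebyshev (Cantelli) inequality P(T - t_n >= y) <= V / (V + y^2) and its
    mirror image, taken at y = c t_n.

    The identity has two halves.  First, the density gamma^t(x) / nu(x)
    decreases in x, so the separation is 1 - gamma^t(m) / nu(m)
    ([sep_semigroup]).  This holds in continuous time for every birth and death
    chain because I + K maps decreasing functions to decreasing functions
    ([lazy_kernel_monotone]).  Second, gamma^t(m) / nu(m) = P(T <= t)
    ([hypoexp_semigroup]).  Put v_m = delta_m / nu(m) and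
    v_{i-1} = (I - L / lam_i) v_i.  Then F_i(t) = (e^{-tL} v_i)(0) satisfies
    F_i' = lam_i (F_{i-1} - F_i), which is the equation of the distribution
    function of the sum of the first i exponentials.  The boundary values are
    right: F_0 = 1 because Cayley-Hamilton makes v_0 harmonic, hence constant,
    while nu v_0 = nu v_m = 1; and F_i(0) = v_i(0) = 0 for i > 0, because v_i is
    a polynomial of degree m - i in the tridiagonal L applied to delta_m.  That
    the rates are positive is the simplicity of the eigenvalue 0 ([lam_gt0]).

    No random variable has to be constructed.  The system
    F_i' = lam_i (F_{i-1} - F_i) preserves nonnegativity, so a bound on F_m
    follows once a solution of the same system dominates F at time 0 and at
    level 0.  For a quadratic p the function t |-> E p(T_i - t), with T_i the
    i-th partial sum, is an explicit solution, and comparison with it is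
    Cantelli's inequality.

    Parts (i) and (iii) are then real analysis on the profile t |-> P(T > t):
    it is nonincreasing, it satisfies the two bounds of part (ii), and it is at
    least P(Exp(lam 1) > t) = exp(- lam 1 t).  The last bound shows that the
    scale s of a cut-off has lam 1 s -> oo, and the upper bound at c = 1 shows
    that s is at most a constant multiple of t_n. *)

(** * Differential inequalities *)

Section Calculus.
Variable R : realType.

Lemma derive_ge0_le (f df : R -> R) (s t : R) :
  (forall x, is_derive x (1 : R) f (df x)) ->
  (forall x, s <= x <= t -> 0 <= df x) -> s <= t -> f s <= f t.
Proof.
move=> fE df0; rewrite le_eqVlt => /predU1P[->//|st].
have fc : {within `[s, t], continuous f}.
  apply: continuous_subspaceT => x.
  exact/differentiable_continuous/derivable1_diffP.
have [x + fst] := MVT st (fun x _ => fE x) fc.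
rewrite in_itv /= => /andP[sx xt].
by rewrite -subr_ge0 fst mulr_ge0 ?subr_ge0 ?(ltW st)// df0 // !ltW.
Qed.

Lemma is_derive_expRM (l x : R) :
  is_derive x (1 : R) (fun y => expR (l * y)) (l * expR (l * x)).
Proof.
have -> : (fun y => expR (l * y)) = expR \o (l *: (id : R -> R)) by [].
apply: is_derive_eq; rewrite /GRing.scale /= mulr1; exact: mulrC.
Qed.

Lemma is_derive_exp_coeff (c x : R) k :
  is_derive x (1 : R) (fun u => exp_coeff (c * u) k.+1)
    (c * exp_coeff (c * x) k).
Proof.
have -> : (fun u => exp_coeff (c * u) k.+1) =
    (k.+1`!%:R)^-1 *: (c *: (id : R -> R)) ^+ k.+1.
  by apply/funext => u; rewrite /exp_coeff /= [LHS]mulrC !fctE.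
apply: is_derive_eq (is_deriveZ _ (is_deriveX k.+1
  (is_deriveZ c (is_derive_id x (1 : R))))) _.
rewrite /GRing.scale /= factS natrM /exp_coeff /=.
by field; rewrite nat1r !pnatr_eq0 -lt0n fact_gt0.
Qed.

(** Multiplying by the integrating factor exp(l x) turns the hypothesis into
    monotonicity of exp(l x) f x. *)
Lemma relaxation_ge0 (f df : R -> R) (l t : R) :
  (forall x, is_derive x (1 : R) f (df x)) ->
  (forall x, 0 <= x -> 0 <= df x + l * f x) ->
  0 <= f 0 -> 0 <= t -> 0 <= f t.
Proof.
move=> fE fl f0 t0.
have eE := is_derive_expRM l.
have gE x : is_derive x (1 : R) ((fun y => expR (l * y)) * f)
    (expR (l * x) * (df x + l * f x)).
  apply: is_derive_eq (is_deriveM (eE x) (fE x)) _.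
  by rewrite /GRing.scale /=; ring.
have /(_ _)/wrap[x /andP[x0 _]|] := derive_ge0_le gE _ t0.
  by rewrite mulr_ge0 ?expR_ge0 // fl.
rewrite !fctE mulr0 expR0 mul1r.
by move=> /(le_trans f0); rewrite pmulr_rge0 ?expR_gt0.
Qed.

(** * Exponential generating functions *)

Definition egf (a : nat -> R) (t : R) : R :=
  limn (series (fun k => t ^+ k / k`!%:R * a k)).

Definition seq_bounded (a : nat -> R) := exists M, forall k, `|a k| <= M.

Lemma egf_cvg a t : seq_bounded a ->
  cvgn (series (fun k => t ^+ k / k`!%:R * a k)).
Proof.
case=> M aM; apply: normed_cvg.
pose v k : R := M * exp_coeff `|t| k.
apply: (@series_le_cvg _ _ v) => [k|k|k|].
- exact: normr_ge0.
- by rewrite mulr_ge0 ?exp_coeff_ge0 // (le_trans _ (aM 0%N)).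
- rewrite /= normrM mulrC /v /exp_coeff /= ler_pM //.
  by rewrite normrM normrX normfV [`|k`!%:R|]ger0_norm.
- exact/is_cvg_seriesZ/is_cvg_series_exp_coeff.
Qed.

Lemma egf_pseries a t : series (fun k => t ^+ k / k`!%:R * a k) =
  pseries (fun k => a k / k`!%:R : R) t.
Proof.
rewrite /pseries; congr series; apply/funext => k.
by rewrite mulrC mulrA mulrAC.
Qed.

Lemma is_derive_egf a t : seq_bounded a ->
  is_derive t (1 : R) (egf a) (egf (fun k => a k.+1) t).
Proof.
move=> aB.
have dE b : pseries_diffs (fun k => b k / k`!%:R) =
            (fun k => b k.+1 / k`!%:R : R).
  apply/funext => k; rewrite /pseries_diffs factS natrM invfM mulrCA.
  by rewrite [X in _ * X]mulrA divff ?mul1r // pnatr_eq0.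
have cE b : seq_bounded b ->
    cvgn (pseries (fun k => b k / k`!%:R) (`|t| + 1)).
  by move=> /egf_cvg - /(_ (`|t| + 1)); rewrite egf_pseries.
have sB (b : nat -> R) : seq_bounded b -> seq_bounded (fun k => b k.+1).
  by case=> M bM; exists M => k.
rewrite /egf; under eq_fun do rewrite egf_pseries.
rewrite egf_pseries -dE; apply: (@pseries_snd_diffs _ _ (`|t| + 1)).
- exact: cE.
- by rewrite dE; exact: (cE _ (sB _ aB)).
- by rewrite !dE; exact: (cE _ (sB _ (sB _ aB))).
- by rewrite [ltRHS]ger0_norm ?ltrDl ?addr_ge0.
Qed.

Lemma egf0 a : egf a 0 = a 0%N.
Proof.
apply: lim_near_cst => //; near=> k; rewrite /series /=.
rewrite -[k]prednK; last by near: k; exists 1%N.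
rewrite big_nat_recl // big1 ?addr0 => [|i _]; last by rewrite exprS !mul0r.
by rewrite expr0 invr1 !mul1r.
Unshelve. all: by end_near. Qed.

Lemma egf1 t : egf (fun=> 1) t = expR t.
Proof. by rewrite /egf /expR; under eq_fun do rewrite mulr1. Qed.

Lemma egf_ge0 a t : seq_bounded a -> (forall k, 0 <= a k) -> 0 <= t ->
  0 <= egf a t.
Proof.
move=> aB a0 t0; apply: limr_ge; first exact: egf_cvg.
apply: nearW => k; apply: sumr_ge0 => i _.
by rewrite mulr_ge0 // divr_ge0 ?exprn_ge0.
Qed.

Lemma egf_lin a b c t : seq_bounded a -> seq_bounded b ->
  egf (fun k => c * a k + b k) t = c * egf a t + egf b t.
Proof.
move=> aB bB; have ca := egf_cvg (t := t) aB; have cb := egf_cvg (t := t) bB.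
rewrite /egf.
rewrite (_ : (fun k => _ * (_ + _)) = c *: (fun k => t ^+ k / k`!%:R * a k) +
  (fun k => t ^+ k / k`!%:R * b k)); last first.
  by apply/funext => k; rewrite !fctE /GRing.scale /= mulrDr mulrCA.
by rewrite lim_seriesD //; [rewrite lim_seriesZ | exact: is_cvg_seriesZ].
Qed.

End Calculus.

(** * Hypoexponential distribution functions *)

Section Hypoexponential.
Variables (R : realType) (m : nat) (l : nat -> R).

(** The forward equations of a sum of independent exponentials with rates
    l 1, ..., l m: both the distribution functions of the partial sums T_i and,
    for a fixed function p, the expectations t |-> E p(T_i - t) solve them. *)
Definition relaxation_chain (G : nat -> R -> R) :=
  forall i t, (i < m)%N ->
    is_derive t (1 : R) (G i.+1) (l i.+1 * (G i t - G i.+1 t)).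

(** These conditions characterise F i as the distribution function, on t >= 0,
    of the sum of independent exponentials with rates l 1, ..., l i. *)
Definition hypoexp (F : nat -> R -> R) :=
  [/\ forall t, F 0%N t = 1, forall i, (i < m)%N -> F i.+1 0 = 0
    & relaxation_chain F].

Definition hypoexp_mean i := \sum_(1 <= j < i.+1) (l j)^-1.
Definition hypoexp_var i := \sum_(1 <= j < i.+1) (l j)^-2.

Hypothesis l_gt0 : forall i, (i < m)%N -> 0 < l i.+1.

Lemma hypoexp_meanS i : hypoexp_mean i.+1 = hypoexp_mean i + (l i.+1)^-1.
Proof. by rewrite /hypoexp_mean big_nat_recr. Qed.

Lemma hypoexp_varS i : hypoexp_var i.+1 = hypoexp_var i + (l i.+1)^-2.
Proof. by rewrite /hypoexp_var big_nat_recr. Qed.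

Lemma hypoexp_mean_ge0 i : (i <= m)%N -> 0 <= hypoexp_mean i.
Proof.
elim: i => [|i IH] im; first by rewrite /hypoexp_mean big_geq.
by rewrite hypoexp_meanS addr_ge0 ?IH ?invr_ge0 1?ltnW // ltW // l_gt0.
Qed.

Lemma hypoexp_var_ge0 i : 0 <= hypoexp_var i.
Proof. by apply: sumr_ge0 => j _; rewrite invr_ge0 sqr_ge0. Qed.

(** The comparison principle: level i is a relaxation towards level i - 1, so
    signs propagate upwards from level 0. *)
Lemma relaxation_chain_ge0 G : relaxation_chain G ->
  (forall t, 0 <= t -> 0 <= G 0%N t) ->
  (forall i, (i < m)%N -> 0 <= G i.+1 0) ->
  forall i t, (i <= m)%N -> 0 <= t -> 0 <= G i t.
Proof.
move=> GE G0 Gi0; elim=> [|i IH] t im t0; first exact: G0.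
apply: (relaxation_ge0 (l := l i.+1) (fun x => GE i x im)) => // [x x0|].
  rewrite mulrBr subrK mulr_ge0 //; first exact/ltW/l_gt0.
  exact: IH (ltnW im) x0.
exact: Gi0.
Qed.

Lemma relaxation_chain_lin G H (a : R) : relaxation_chain G ->
  relaxation_chain H -> relaxation_chain (fun i t => G i t + a * H i t).
Proof.
move=> GE HE i t im.
have -> : (fun t => G i.+1 t + a * H i.+1 t) = G i.+1 + a *: H i.+1 by [].
apply: is_derive_eq (is_deriveD (GE i t im) (is_deriveZ a (HE i t im))) _.
by rewrite /GRing.scale /=; ring.
Qed.

Lemma relaxation_chain_cst (a : R) : relaxation_chain (fun _ _ => a).
Proof. by move=> i t _; apply: is_derive_eq; rewrite subrr mulr0. Qed.

(** The solution E (T_i + b - t)^2, with T_i the i-th partial sum. *)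
Lemma relaxation_chain_quad (b : R) : relaxation_chain
  (fun i t => hypoexp_var i + (hypoexp_mean i + b - t) ^+ 2).
Proof.
move=> i t im.
have -> : (fun t => hypoexp_var i.+1 + (hypoexp_mean i.+1 + b - t) ^+ 2) =
  cst (hypoexp_var i.+1) + (cst (hypoexp_mean i.+1 + b) - id) ^+ 2 by [].
apply: is_derive_eq (is_deriveD (is_derive_cst _ t (1 : R)) (is_deriveX 2
  (is_deriveB (is_derive_cst _ t (1 : R)) (is_derive_id t (1 : R))))) _.
rewrite !fctE /GRing.scale /= hypoexp_meanS hypoexp_varS.
by field; exact: lt0r_neq0 (l_gt0 im).
Qed.

Variable F : nat -> R -> R.
Hypothesis FE : hypoexp F.

Lemma hypoexp_ge0 i t : (i <= m)%N -> 0 <= t -> 0 <= F i t.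
Proof.
case: FE => F0 Fi0 FD; apply: relaxation_chain_ge0 => // [s _|j jm].
  by rewrite F0.
by rewrite Fi0.
Qed.

Lemma hypoexp_le1 i t : (i <= m)%N -> 0 <= t -> F i t <= 1.
Proof.
case: FE => F0 Fi0 FD im t0.
have GE := relaxation_chain_lin (-1) (relaxation_chain_cst 1) FD.
have := relaxation_chain_ge0 GE _ _ im t0.
move=> H; rewrite -subr_ge0 -mulN1r; apply: H => [s _|j jm].
  by rewrite F0 mulN1r subrr.
by rewrite Fi0 // mulr0 addr0.
Qed.

(** Adding an exponential variable makes the sum stochastically larger. *)
Lemma hypoexp_anti i t : (i < m)%N -> 0 <= t -> F i.+1 t <= F i t.
Proof.
case: FE => F0 Fi0 FD; elim: i t => [|i IH] t im t0.
  by rewrite F0 hypoexp_le1.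
rewrite -subr_ge0.
have D1 x := FD i x (ltnW im); have D2 x := FD i.+1 x im.
have D x := is_deriveB (D1 x) (D2 x).
apply: (relaxation_ge0 (l := l i.+2) D) => // [x x0|].
  rewrite !fctE subrK mulr_ge0 ?subr_ge0 ?IH 1?ltnW //; exact/ltW/l_gt0/ltnW.
by rewrite !fctE !Fi0 ?subrr // ltnW.
Qed.

Lemma hypoexp_homo i s t : (i <= m)%N -> 0 <= s -> s <= t -> F i s <= F i t.
Proof.
case: FE => F0 Fi0 FD; case: i => [|i] im s0 st; first by rewrite !F0.
apply: derive_ge0_le (fun x => FD i x im) _ st => x /andP[/(le_trans s0) x0 _].
rewrite mulr_ge0 ?subr_ge0 ?hypoexp_anti //; exact/ltW/l_gt0.
Qed.

Lemma hypoexp_le_exp n t : (n < m)%N -> 0 <= t ->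
  F n.+1 t <= 1 - expR (- l 1%N * t).
Proof.
case: FE => F0 Fi0 FD; elim: n t => [|n IH] t nm t0; last first.
  by apply: le_trans (IH _ (ltnW nm) t0); exact: hypoexp_anti.
have D1 x := FD 0%N x nm.
have D x := is_deriveB (is_deriveB (is_derive_cst (1 : R) x (1 : R))
  (is_derive_expRM (- l 1%N) x)) (D1 x).
rewrite -subr_ge0.
apply: (relaxation_ge0 (l := l 1%N) D) => // [x x0|].
  rewrite !fctE F0; nra.
by rewrite !fctE Fi0 // mulr0 expR0 !subrr.
Qed.

(** Markov's inequality for (T + b - t)^2, which is at least b^2 on T >= t. *)
Lemma hypoexp_tail b t : 0 <= b -> 0 <= t ->
  b ^+ 2 * (1 - F m t) <= hypoexp_var m + (hypoexp_mean m + b - t) ^+ 2.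
Proof.
case: FE => F0 Fi0 FD b0 t0.
have GE := relaxation_chain_lin (b ^+ 2) (relaxation_chain_lin (- b ^+ 2)
  (relaxation_chain_quad b) (relaxation_chain_cst 1)) FD.
have := relaxation_chain_ge0 GE _ _ (leqnn m) t0 => H; rewrite -subr_ge0.
suff: 0 <= hypoexp_var m + (hypoexp_mean m + b - t) ^+ 2 + - b ^+ 2 * 1 +
    b ^+ 2 * F m t by lra.
apply: H => [s _|i im].
  rewrite F0; have := sqr_ge0 (hypoexp_mean 0 + b - s).
  have := hypoexp_var_ge0 0; lra.
rewrite Fi0 //; have := hypoexp_var_ge0 i.+1.
have := hypoexp_mean_ge0 im; nra.
Qed.

(** Markov's inequality for (T - b - t)^2, which is at least b^2 on T <= t. *)
Lemma hypoexp_head b t : 0 <= b -> 0 <= t ->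
  b ^+ 2 * F m t <= hypoexp_var m + (hypoexp_mean m - b - t) ^+ 2.
Proof.
case: FE => F0 Fi0 FD b0 t0.
have GE := relaxation_chain_lin (- b ^+ 2) (relaxation_chain_quad (- b)) FD.
have := relaxation_chain_ge0 GE _ _ (leqnn m) t0 => H.
suff: 0 <= hypoexp_var m + (hypoexp_mean m + - b - t) ^+ 2 + - b ^+ 2 * F m t
  by lra.
apply: H => [s s0|i im].
  rewrite F0 /hypoexp_var /hypoexp_mean !big_geq //; nra.
rewrite Fi0 //; have := hypoexp_var_ge0 i.+1.
have := sqr_ge0 (hypoexp_mean i.+1 - b - 0); lra.
Qed.

Lemma hypoexp_var_le : (forall i, (i < m)%N -> l 1%N <= l i.+1) ->
  l 1%N * hypoexp_var m <= hypoexp_mean m.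
Proof.
move=> l1; rewrite /hypoexp_var /hypoexp_mean mulr_sumr !big_add1 /= !big_nat.
apply: ler_sum => i /= im; have li := l_gt0 im.
rewrite expr2 invfM mulrA ler_piMl ?invr_ge0 ?(ltW li) //.
by rewrite ler_pdivrMr ?mul1r ?l1.
Qed.

Lemma hypoexp_mean_gt0 : (0 < m)%N -> 0 < hypoexp_mean m.
Proof.
case: m l_gt0 => // n lgt0 _; rewrite /hypoexp_mean big_nat_recl //=.
rewrite ltr_pwDl ?invr_gt0 ?lgt0 // big_add1 big_nat sumr_ge0 // => i /= im.
by rewrite invr_ge0 ltW // lgt0.
Qed.

(** Minimising the bound of Markov's inequality over the shift b yields
    Cantelli's inequality, with the variance replaced by its upper bound
    W = mean / l 1. *)
Lemma cantelli_optimum (X c : R) : (0 < m)%N -> 0 < c ->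
  (forall i, (i < m)%N -> l 1%N <= l i.+1) ->
  (forall b, 0 <= b ->
     b ^+ 2 * X <= hypoexp_var m + (b - c * hypoexp_mean m) ^+ 2) ->
  X <= (1 + c ^+ 2 * (l 1%N * hypoexp_mean m))^-1.
Proof.
move=> m0 c0 l1 Xb; have Vle := hypoexp_var_le l1.
have mu0 := hypoexp_mean_gt0 m0; have l10 := l_gt0 m0.
set mu := hypoexp_mean m in Xb Vle mu0 *; set V := hypoexp_var m in Xb Vle.
have y0 : 0 < c * mu by rewrite mulr_gt0.
(* For deviation y = c mu and variance W the optimal shift is y + W / y. *)
pose W := mu / l 1%N; have W0 : 0 < W by rewrite divr_gt0.
pose b := c * mu + W / (c * mu).
have b0 : 0 < b by rewrite addr_gt0 ?divr_gt0.
have b20 : 0 < b ^+ 2 by rewrite exprn_gt0.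
have -> : (1 + c ^+ 2 * (l 1%N * mu))^-1 = (W + (b - c * mu) ^+ 2) / b ^+ 2.
  have D : 0 < c * mu * (l 1%N * c) + 1.
    by rewrite addr_gt0 // !mulr_gt0.
  by rewrite /b /W; field; rewrite !lt0r_neq0.
rewrite ler_pdivlMr // mulrC (le_trans (Xb _ (ltW b0))) // lerD2r.
by rewrite /W ler_pdivlMr // mulrC.
Qed.

Lemma hypoexp_cantelli_upper c : (0 < m)%N -> 0 < c ->
  (forall i, (i < m)%N -> l 1%N <= l i.+1) ->
  1 - F m ((1 + c) * hypoexp_mean m) <=
    (1 + c ^+ 2 * (l 1%N * hypoexp_mean m))^-1.
Proof.
move=> m0 c0 l1; apply: cantelli_optimum => // b b0.
have t0 : 0 <= (1 + c) * hypoexp_mean m.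
  by rewrite mulr_ge0 ?addr_ge0 ?ltW // hypoexp_mean_gt0.
apply: le_trans (hypoexp_tail b0 t0) _; rewrite lerD2l.
by rewrite le_eqVlt; apply/orP; left; apply/eqP; ring.
Qed.

Lemma hypoexp_cantelli_lower c : (0 < m)%N -> 0 < c -> c <= 1 ->
  (forall i, (i < m)%N -> l 1%N <= l i.+1) ->
  F m ((1 - c) * hypoexp_mean m) <=
    (1 + c ^+ 2 * (l 1%N * hypoexp_mean m))^-1.
Proof.
move=> m0 c0 c1 l1; apply: cantelli_optimum => // b b0.
have t0 : 0 <= (1 - c) * hypoexp_mean m.
  by rewrite mulr_ge0 ?subr_ge0 // ltW // hypoexp_mean_gt0.
apply: le_trans (hypoexp_head b0 t0) _; rewrite lerD2l.
by rewrite le_eqVlt; apply/orP; left; apply/eqP; ring.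
Qed.

End Hypoexponential.

(** * Birth and death chains: reversibility and harmonic functions *)

Section BirthDeathChain.
Variables (R : realType) (m : nat) (K : 'M[R]_m.+1) (nu : 'rV[R]_m.+1).
Hypotheses (K_bd : is_birth_death K) (K_irr : bd_irreducible K)
  (nu_stat : is_stationary K nu).

Local Notation L := (1%:M - K).

Lemma kernel_ge0 x y : 0 <= K x y.
Proof. by case: K_bd => /(_ x)[+ _] _ => /(_ y); rewrite mxE. Qed.

Lemma kernel_sum1 x : \sum_y K x y = 1.
Proof. by case: K_bd => /(_ x)[_ <-] _; apply: eq_bigr => y _; rewrite mxE. Qed.

Lemma kernel_eq0 (x y : 'I_m.+1) : ((x.+1 < y) || (y.+1 < x))%N -> K x y = 0.
Proof. by case: K_bd => _; exact. Qed.

Lemma kernel_const1 : K *m const_mx 1 = const_mx 1 :> 'cV_m.+1.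
Proof.
apply/colP => x; rewrite !mxE -[RHS](kernel_sum1 x).
by apply: eq_bigr => y _; rewrite mxE mulr1.
Qed.

Lemma norm_kernel_pow (v : 'cV[R]_m.+1) k x :
  `|(K ^+ k *m v) x 0| <= \sum_y `|v y 0|.
Proof.
elim: k x => [|k IH] x.
  by rewrite expr0 mul1mx (bigD1 x) //= lerDl sumr_ge0.
rewrite exprS -mulmxA mxE; apply: le_trans (ler_norm_sum _ _ _) _.
rewrite -[leRHS]mul1r -(kernel_sum1 x) mulr_suml; apply: ler_sum => y _.
by rewrite normrM ger0_norm ?kernel_ge0 // ler_wpM2l ?kernel_ge0.
Qed.

Lemma nu_ge0 x : 0 <= nu 0 x. Proof. by case: nu_stat => -[]. Qed.

Lemma nu_sum1 : \sum_x nu 0 x = 1. Proof. by case: nu_stat => -[]. Qed.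

Lemma nu_balance x : \sum_y nu 0 y * K y x = nu 0 x.
Proof. by case: nu_stat => _ {2}<-; rewrite mxE. Qed.

(** A tridiagonal flow crosses the cut between x and x + 1 along a single
    edge. *)
Lemma sum_cut_tridiagonal (a : 'I_m.+1 -> 'I_m.+1 -> R) (x y : 'I_m.+1) :
  (forall z w : 'I_m.+1, (z.+1 < w)%N -> a z w = 0) -> y = x.+1 :> nat ->
  \sum_(z : 'I_m.+1 | (z <= x)%N) \sum_(w : 'I_m.+1 | ~~ (w <= x)%N) a z w =
  a x y.
Proof.
move=> a0 yx; rewrite (bigD1 x) //= (bigD1 y) //=; last by rewrite yx ltnn.
rewrite big1 ?addr0 => [|w /andP[wx wy]]; last first.
  by rewrite a0 // -yx ltn_neqAle eq_sym wy yx ltnNge.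
rewrite big1 ?addr0 // => z /andP[zx nzx]; rewrite big1 // => w.
by rewrite -ltnNge => wx; rewrite a0 // (leq_trans _ wx) // ltnS ltn_neqAle nzx.
Qed.

(** Stationarity equates the mass of {0, ..., x} with the mass staying in it
    plus the outflow, and also with the mass staying in it plus the inflow; the
    two flows each use one edge, so they balance. *)
Lemma detailed_balance_succ (x y : 'I_m.+1) :
  y = x.+1 :> nat -> nu 0 x * K x y = nu 0 y * K y x.
Proof.
move=> yx; pose A (z : 'I_m.+1) := (z <= x)%N.
have out : \sum_(z | A z) nu 0 z =
    \sum_(z | A z) \sum_(w | A w) nu 0 z * K z w + nu 0 x * K x y.
  rewrite -(sum_cut_tridiagonal (a := fun z w => nu 0 z * K z w)) //
    => [|z w zw].
    rewrite -big_split; apply: eq_bigr => z _ /=.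
    by rewrite -[LHS]mulr1 -(kernel_sum1 z) mulr_sumr (bigID A).
  by rewrite kernel_eq0 ?zw // mulr0.
have into : \sum_(z | A z) nu 0 z =
    \sum_(z | A z) \sum_(w | A w) nu 0 w * K w z + nu 0 y * K y x.
  rewrite -(sum_cut_tridiagonal (a := fun z w => nu 0 w * K w z)) //
    => [|z w zw].
    rewrite -big_split; apply: eq_bigr => z _ /=.
    by rewrite -[LHS]nu_balance (bigID A).
  by rewrite kernel_eq0 ?zw ?orbT // mulr0.
move: into; rewrite {}out exchange_big /=.
exact: addrI.
Qed.

Lemma detailed_balance x y : nu 0 x * K x y = nu 0 y * K y x.
Proof.
case: (ltngtP x y) => [xy|yx|/val_inj -> //].
- move: (xy); rewrite leq_eqVlt => /predU1P[xy1|xy1].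
    exact: detailed_balance_succ.
  by rewrite !kernel_eq0 ?xy1 ?orbT // !mulr0.
- move: (yx); rewrite leq_eqVlt => /predU1P[xy1|xy1].
    exact/esym/detailed_balance_succ.
  by rewrite !kernel_eq0 ?xy1 ?orbT // !mulr0.
Qed.

(** Detailed balance spreads a zero of nu to its neighbours, which contradicts
    the total mass 1. *)
Lemma nu_gt0 x : 0 < nu 0 x.
Proof.
rewrite lt0r nu_ge0 andbT; apply/negP => /eqP nux.
have step (y z : 'I_m.+1) : nu 0 y = 0 -> 0 < K z y -> nu 0 z = 0.
  move=> nuy Kzy; have := detailed_balance z y; rewrite nuy mul0r.
  by move=> /eqP; rewrite mulf_eq0 (gt_eqF Kzy) orbF => /eqP.
have nu00 : nu 0 ord0 = 0.
  case: x nux => j; elim: j => [|j IH] jm nuj.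
    by rewrite -nuj; congr (nu 0 _); exact: val_inj.
  apply: (IH (ltnW jm)); apply: step nuj _.
  by case: K_irr => _; apply.
have nu0 j (jm : (j < m.+1)%N) : nu 0 (Ordinal jm) = 0.
  elim: j jm => [|j IH] jm.
    by rewrite -nu00; congr (nu 0 _); exact: val_inj.
  apply: step (IH (ltnW jm)) _.
  by case: K_irr => + _; apply.
have := nu_sum1; rewrite big1 => [/eqP|[j jm] _]; last exact: nu0.
by rewrite eq_sym oner_eq0.
Qed.

(** Row j of the equation, once u is constant on {0, ..., j}, reads
    K j (j+1) (u j - u (j+1)) = 0. *)
Lemma harmonic_const (u : 'cV[R]_m.+1) : L *m u = 0 -> u = const_mx (u ord0 0).
Proof.
move=> Lu.
have uE x : \sum_y K x y * (u x 0 - u y 0) = 0.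
  have := congr1 (fun w : 'cV_m.+1 => w x 0) Lu.
  rewrite mulmxBl mul1mx !mxE => LuE; rewrite -[RHS]LuE.
  under eq_bigr do rewrite mulrBr.
  by rewrite sumrB -mulr_suml kernel_sum1 mul1r.
suff uj j (x : 'I_m.+1) : (x <= j)%N -> u x 0 = u ord0 0.
  by apply/colP => x; rewrite mxE (uj x).
elim: j x => [|j IH] y.
  by rewrite leqn0 => /eqP y0; congr (u _ 0); exact: val_inj.
rewrite leq_eqVlt => /predU1P[yj|]; last by rewrite ltnS; exact: IH.
have jm : (j < m.+1)%N by apply: ltn_trans (ltn_ord y); rewrite yj.
pose x := Ordinal jm; have ux : u x 0 = u ord0 0 by exact: IH.
have := uE x; rewrite (bigD1 y) //= big1 => [|z zy]; last first.
  case: (leqP z j) => [zj|jz]; first by rewrite (IH _ zj) ux subrr mulr0.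
  rewrite kernel_eq0 ?mul0r //; apply/orP; left.
  by rewrite /= -yj ltn_neqAle eq_sym zy yj.
rewrite addr0 => /eqP; rewrite mulf_eq0 gt_eqF /= => [|]; last first.
  by case: K_irr => _; apply.
by rewrite subr_eq0 ux => /eqP.
Qed.

Lemma nu_laplacian : nu *m L = 0.
Proof. by case: nu_stat => _; rewrite mulmxBr mulmx1 => ->; rewrite subrr. Qed.

(** A harmonic L u is a constant c, and c = nu (L u) = 0. *)
Lemma laplacian_sq_ker (u : 'cV[R]_m.+1) : L *m (L *m u) = 0 -> L *m u = 0.
Proof.
move=> /harmonic_const; move: ((L *m u) ord0 0) => c LuE.
have := congr1 (mulmx nu) LuE; rewrite mulmxA nu_laplacian mul0mx.
move=> /rowP/(_ 0); rewrite !mxE; under eq_bigr do rewrite mxE.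
rewrite -mulr_suml nu_sum1 mul1r LuE => <-.
by apply/colP => x; rewrite !mxE.
Qed.

(** A path of length k from 0 in the tridiagonal L reaches at most k, and
    reaches k only by going up at every step. *)
Lemma laplacian_pow_corner k (j : 'I_m.+1) :
  ((k < j)%N -> (L ^+ k) ord0 j = 0) /\ (k = j -> (L ^+ k) ord0 j != 0).
Proof.
have L0 (x y : 'I_m.+1) : (x.+1 < y)%N -> L x y = 0.
  move=> xy; rewrite !mxE kernel_eq0 ?xy // subr0.
  rewrite (_ : x == y = false) //; apply/eqP => xy'.
  by move: xy; rewrite xy' ltnNge leqnSn.
elim: k j => [|k IH] j.
  rewrite expr0 !mxE; split=> [|j0].
    by case: eqP => // <-.
  by rewrite (_ : ord0 == j) ?oner_eq0 //; apply/eqP/val_inj.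
rewrite exprSr mxE; split=> [kj|kj].
  rewrite big1 // => i _; case: (ltnP k i) => [ki|ik].
    by rewrite (IH i).1 ?mul0r.
  by rewrite L0 ?mulr0 //; apply: leq_trans kj.
have km : (k < m.+1)%N by rewrite (leq_trans _ (ltn_ord j)) // -kj.
rewrite (bigD1 (Ordinal km)) //= big1 => [|i ik]; last first.
  case: (ltngtP k i) => [ki|ki|ki].
  - by rewrite (IH i).1 ?mul0r.
  - by rewrite L0 ?mulr0 // -kj.
  - by move: ik; rewrite -val_eqE /= -ki eqxx.
rewrite addr0 mulf_neq0 ?(IH _).2 // !mxE.
have -> : (Ordinal km == j) = false.
  by apply/eqP => jE; move: kj; rewrite -jE /= => /esym/n_Sn.
by rewrite sub0r oppr_eq0 gt_eqF //; case: K_irr => _; apply.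
Qed.

Lemma horner_laplacian_corner (p : {poly R}) (j : 'I_m.+1) :
  ((size p <= j)%N -> (horner_mx L p) ord0 j = 0) /\
  (size p = j.+1 -> (horner_mx L p) ord0 j != 0).
Proof.
have pE : horner_mx L p = \sum_(i < size p) p`_i *: L ^+ i.
  rewrite -{1}[p]coefK poly_def rmorph_sum; apply: eq_bigr => i _ /=.
  by rewrite horner_mxZ rmorphXn /= horner_mx_X.
have pE0 n : (n <= j)%N -> (\sum_(i < n) p`_i *: L ^+ i) ord0 j = 0.
  move=> nj; rewrite summxE big1 // => i _.
  by rewrite mxE (laplacian_pow_corner i j).1 ?mulr0 // (leq_trans (ltn_ord i)).
rewrite pE; split=> [|pj]; first exact: pE0.
rewrite pj big_ord_recr /= mxE pE0 // add0r mxE mulf_neq0 //.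
  have <- : lead_coef p = p`_j by rewrite lead_coefE pj.
  by rewrite lead_coef_eq0 -size_poly_eq0 pj.
exact: (laplacian_pow_corner j j).2.
Qed.

(** * The spectrum of the Laplacian *)

Variable lam : nat -> R.
Hypotheses (m_gt0 : (0 < m)%N) (lamE : ordered_eigenvalues L lam).

Lemma eigenvalue_laplacianP a :
  reflect (exists2 i, (i < m.+1)%N & a = lam i) (eigenvalue L a).
Proof.
case: lamE => _ chiE; rewrite eigenvalue_root_char chiE rootE horner_prod.
apply: (iffP (prodf_eq0 _ _)) => [[i _]|[i im ->]].
  by rewrite hornerXsubC subr_eq0 => /eqP ->; exists i.
by exists (Ordinal im); rewrite // hornerXsubC subrr.
Qed.

(** For a left eigenvector u one has u K = (1 - a) u, and a Markov kernel
    contracts the l1 norm of row vectors, so |1 - a| <= 1. *)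
Lemma eigenvalue_laplacian_ge0 a : eigenvalue L a -> 0 <= a.
Proof.
move=> /eigenvalueP[u uL u0].
have uK : u *m K = (1 - a) *: u.
  rewrite scalerBl scale1r -uL mulmxBr mulmx1; apply/rowP => x.
  by rewrite !mxE opprB addrC subrK.
have S0 : 0 < \sum_x `|u 0 x|.
  rewrite lt0r sumr_ge0 // andbT; apply: contra u0.
  rewrite psumr_eq0 // => /allP u0; apply/eqP/rowP => x; rewrite mxE.
  by apply/eqP; rewrite -normr_eq0; apply: u0; rewrite mem_index_enum.
suff : `|1 - a| <= 1 by rewrite ler_norml => /andP[_]; lra.
rewrite -(ler_pM2r S0) mul1r mulr_sumr.
have -> : \sum_x `|1 - a| * `|u 0 x| = \sum_x `|(u *m K) 0 x|.
  by apply: eq_bigr => x _; rewrite uK mxE normrM.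
have -> : \sum_x `|u 0 x| = \sum_x \sum_y `|u 0 x| * K x y.
  by apply: eq_bigr => x _; rewrite -mulr_sumr kernel_sum1 mulr1.
rewrite exchange_big /=; apply: ler_sum => x _; rewrite mxE.
apply: le_trans (ler_norm_sum _ _ _) _; apply: ler_sum => y _.
by rewrite normrM (ger0_norm (kernel_ge0 _ _)).
Qed.

Lemma lam0 : lam 0%N = 0.
Proof.
have /eigenvalue_laplacianP[i im li] : eigenvalue L 0.
  apply/eigenvalueP; exists nu; first by rewrite nu_laplacian scale0r.
  by apply/eqP => nu0; have := nu_gt0 ord0; rewrite nu0 mxE ltxx.
apply/eqP; rewrite eq_le {1}li lamE.1 //=.
by apply: eigenvalue_laplacian_ge0; apply/eigenvalue_laplacianP; exists 0%N.
Qed.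

(** If 0 were a double root, the characteristic polynomial would be X^2 Q, and
    L^2 Q(L) = 0 would improve to L Q(L) = 0 because L^2 and L have the same
    kernel.  But X Q has degree m, so the corner entry (0, m) of L Q(L) does not
    vanish. *)
Lemma lam_gt0 i : (i < m)%N -> 0 < lam i.+1.
Proof.
move=> im; case: (lamE) => lam_le chiE.
apply: (@lt_le_trans _ _ (lam 1%N)); last by apply: lam_le.
rewrite lt0r -(lam0) lam_le ?andbT //; apply/negP => /eqP lam10.
pose Q : {poly R} := \prod_(i < m.-1) ('X - (lam i.+2)%:P).
have chiQ : char_poly L = 'X * ('X * Q).
  rewrite chiE -(prednK m_gt0) !big_ord_recl /= lam10 lam0 subr0.
  by congr ('X * ('X * _)); apply: eq_bigr.
have := Cayley_Hamilton L; rewrite chiQ !rmorphM /= !horner_mx_X.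
rewrite -!mulmxE => LLQ.
have LQ : L *m horner_mx L Q = 0.
  apply/matrixP => x y.
  have := @laplacian_sq_ker (horner_mx L Q *m delta_mx y 0).
  rewrite !mulmxA -[L *m L *m _]mulmxA LLQ mul0mx -colE.
  by move=> /(_ erefl)/colP/(_ x); rewrite !mxE.
have sQ : size ('X * Q) = (@ord_max m).+1.
  rewrite mulrC size_mulX ?size_prod_XsubC; last first.
    by apply/monic_neq0/monic_prod_XsubC.
  by rewrite /index_enum -enumT -cardE card_ord prednK.
have := (horner_laplacian_corner ('X * Q) ord_max).2 sQ.
by rewrite rmorphM /= horner_mx_X -mulmxE LQ mxE eqxx.
Qed.

(** * The continuous-time semigroup *)

(** This is (e^{-tL} v)(0), expanded as e^{-t} sum t^k / k! (K^k v)(0). *)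
Definition semigroup_at0 (v : 'cV[R]_m.+1) (t : R) :=
  expR (- t) * egf (fun k => (K ^+ k *m v) ord0 0) t.

Lemma kernel_pow_bounded (v : 'cV[R]_m.+1) :
  seq_bounded (fun k => (K ^+ k *m v) ord0 0).
Proof. by exists (\sum_y `|v y 0|) => k; exact: norm_kernel_pow. Qed.

Lemma semigroup_at0D u v t :
  semigroup_at0 (u + v) t = semigroup_at0 u t + semigroup_at0 v t.
Proof.
rewrite /semigroup_at0 -mulrDr -[egf _ t in RHS]mul1r.
rewrite -egf_lin; try exact: kernel_pow_bounded.
by congr (_ * egf _ t); apply/funext => k; rewrite mulmxDr mul1r mxE.
Qed.

Lemma semigroup_at0Z c v t : semigroup_at0 (c *: v) t = c * semigroup_at0 v t.
Proof.
rewrite /semigroup_at0 mulrCA; congr (_ * _).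
have B0 : seq_bounded (fun=> 0 : R) by exists 0 => k; rewrite normr0.
have E0 : egf (fun=> 0 : R) t = 0.
  rewrite -[RHS](addNr (egf (fun=> 0) t)) -mulN1r -egf_lin //.
  by congr (egf _ t); apply/funext => k; rewrite mulr0 addr0.
rewrite -[RHS]addr0 -[X in _ + X]E0 -egf_lin //; last first.
  exact: kernel_pow_bounded.
by congr (egf _ t); apply/funext => k; rewrite -scalemxAr mxE addr0.
Qed.

Lemma semigroup_at0_sum (I : finType) (v : I -> 'cV[R]_m.+1) t :
  semigroup_at0 (\sum_i v i) t = \sum_i semigroup_at0 (v i) t.
Proof.
apply: (big_morph (semigroup_at0^~ t)) => [u w|]; first exact: semigroup_at0D.
by rewrite -(scale0r 0) semigroup_at0Z mul0r.
Qed.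

Lemma is_derive_semigroup_at0 v t :
  is_derive t (1 : R) (semigroup_at0 v) (- semigroup_at0 (L *m v) t).
Proof.
have eE := is_derive_expRM (-1) t.
have fE := is_derive_egf t (kernel_pow_bounded v).
have -> : semigroup_at0 v =
    (fun s => expR (-1 * s)) * egf (fun k => (K ^+ k *m v) ord0 0).
  by apply/funext => s; rewrite /semigroup_at0 fctE mulN1r.
apply: is_derive_eq.
rewrite mulmxBl mul1mx -[- (K *m v)]scaleN1r semigroup_at0D semigroup_at0Z.
rewrite /semigroup_at0 /GRing.scale /= mulN1r.
under [X in egf X]eq_fun do rewrite exprSr -mulmxA.
ring.
Qed.

Lemma semigroup_at00 v : semigroup_at0 v 0 = v ord0 0.
Proof. by rewrite /semigroup_at0 oppr0 expR0 mul1r egf0 expr0 mul1mx. Qed.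

Lemma semigroup_at0_const1 t : semigroup_at0 (const_mx 1) t = 1.
Proof.
rewrite /semigroup_at0 -[RHS](expRxMexpNx_1 t) mulrC -(egf1 t).
congr (egf _ t * _).
apply/funext => k; rewrite (_ : _ *m _ = const_mx 1) ?mxE //.
by elim: k => [|k IH]; rewrite ?expr0 ?mul1mx // exprSr -mulmxA kernel_const1.
Qed.

Lemma ct_lawE t x : ct_law K t 0 x = semigroup_at0 (delta_mx x 0) t.
Proof.
by rewrite mxE /semigroup_at0; under [in RHS]eq_fun do rewrite -colE mxE.
Qed.

Lemma nu_horner_laplacian p : nu *m horner_mx L p = p.[0] *: nu.
Proof.
elim/poly_ind: p => [|p c _]; first by rewrite rmorph0 mulmx0 horner0 scale0r.
rewrite hornerMXaddC mulr0 add0r mulrC rmorphD rmorphM /= horner_mx_X.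
rewrite horner_mx_C.
by rewrite mulmxDr -mulmxE mulmxA nu_laplacian mul0mx add0r mul_mx_scalar.
Qed.

(** * The spectral chain of test functions *)

(** The column vectors v_i = (I - L / lam_(i+1)) ... (I - L / lam_m) v_m, where
    v_m is the point mass at m divided by nu(m). *)
Definition spectral_fun i : 'cV[R]_m.+1 :=
  horner_mx L (\prod_(i.+1 <= j < m.+1) (1 - (lam j)^-1 *: 'X)) *m
  ((nu 0 ord_max)^-1 *: delta_mx (@ord_max m) 0).

Lemma spectral_fun_max :
  spectral_fun m = (nu 0 ord_max)^-1 *: delta_mx (@ord_max m) 0.
Proof. by rewrite /spectral_fun big_geq // rmorph1 mul1mx. Qed.

Lemma spectral_fun_step i : (i < m)%N ->
  L *m spectral_fun i.+1 = lam i.+1 *: (spectral_fun i.+1 - spectral_fun i).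
Proof.
move=> im.
have -> : spectral_fun i =
    spectral_fun i.+1 - (lam i.+1)^-1 *: (L *m spectral_fun i.+1).
  rewrite /spectral_fun [in LHS]big_ltn // rmorphM rmorphB rmorph1 /= -mulmxE.
  by rewrite -mulmxA mulmxBl mul1mx horner_mxZ horner_mx_X -scalemxAl.
rewrite subKr scalerA divff ?scale1r //.
by rewrite gt_eqF // lam_gt0.
Qed.

(** The product over all nonzero eigenvalues times L is a multiple of the
    characteristic polynomial of L, so spectral_fun 0 is harmonic and therefore
    constant.  The constant is 1 since nu is fixed by each factor. *)
Lemma spectral_fun0 : spectral_fun 0 = const_mx 1.
Proof.
have chiE : 'X * \prod_(1 <= j < m.+1) (1 - (lam j)^-1 *: 'X) =
    (\prod_(1 <= j < m.+1) - (lam j)^-1) *: char_poly L.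
  rewrite lamE.2 big_ord_recl /= lam0 subr0 scalerAr; congr (_ * _).
  rewrite !big_add1 /= !big_mkord -scaler_prod; apply: eq_bigr => j _.
  have lj : lam j.+1 != 0 by rewrite gt_eqF // lam_gt0.
  apply/polyP => k; rewrite !(coefB, coefZ, coef1, coefX, coefC).
  by case: k => [|[|k]] /=; field.
have Lv : L *m spectral_fun 0 = 0.
  rewrite mulmxA mulmxE -{1}(horner_mx_X L) -rmorphM chiE /=.
  by rewrite horner_mxZ Cayley_Hamilton scaler0 mul0mx.
have nuv : nu *m spectral_fun 0 = 1%:M.
  rewrite mulmxA nu_horner_laplacian horner_prod big1 => [|j _]; last first.
    by rewrite !hornerE ?mulr0 ?oppr0 ?addr0 ?subr0.
  apply/matrixP => x y; rewrite !ord1 scale1r -scalemxAr -colE !mxE.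
  by rewrite mulVf // gt_eqF // nu_gt0.
have := harmonic_const Lv; move: (spectral_fun 0 ord0 0) => c vE.
rewrite vE; congr const_mx; move: nuv; rewrite vE => /matrixP/(_ 0 0).
rewrite !mxE; under eq_bigr do rewrite mxE.
by rewrite -mulr_suml nu_sum1 mul1r.
Qed.

(** The polynomial has degree less than m, so its corner entry vanishes. *)
Lemma spectral_fun_at0 i : (i < m)%N -> spectral_fun i.+1 ord0 0 = 0.
Proof.
move=> im; rewrite /spectral_fun -scalemxAr -colE mxE mxE.
rewrite (horner_laplacian_corner _ _).1 ?mulr0 //.
have sP (s : seq nat) : (size (\prod_(j <- s) (1 - (lam j)^-1 *: 'X))%R <=
    (size s).+1)%N.
  elim: s => [|j s IH]; first by rewrite big_nil size_poly1.
  rewrite big_cons; apply: leq_trans (size_polyMleq _ _) _.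
  have : (size (1 - (lam j)^-1 *: 'X)%R <= 2)%N.
    apply: leq_trans (size_polyD _ _) _; rewrite geq_max size_poly1 /=.
    by rewrite size_polyN (leq_trans (size_scale_leq _ _)) // size_polyX.
  move: IH => /=; set a := size _; set b := size _ => ba aa.
  by rewrite -subn1 leq_subLR (leq_trans (leq_add aa ba)).
by apply: leq_trans (sP _) _; rewrite size_iota subSS subnSK // leq_subr.
Qed.

(** At level m this identifies gamma^t(m) / nu(m) with the probability that a
    sum of exponentials with the nonzero eigenvalues as rates is at most t. *)
Lemma hypoexp_semigroup :
  hypoexp m lam (fun i => semigroup_at0 (spectral_fun i)).
Proof.
split=> [t|i im|i t im].
- by rewrite spectral_fun0 semigroup_at0_const1.
- by rewrite semigroup_at00 spectral_fun_at0.
apply: is_derive_eq; first exact: is_derive_semigroup_at0.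
rewrite spectral_fun_step // (semigroup_at0Z (lam i.+1)).
rewrite -[- spectral_fun i]scaleN1r (semigroup_at0D (spectral_fun i.+1)).
by rewrite (semigroup_at0Z (-1)) mulN1r -mulrN opprB.
Qed.

(** * Monotonicity of the density and the separation *)

Lemma semigroup_at0_delta_ge0 x t :
  0 <= t -> 0 <= semigroup_at0 (delta_mx x 0) t.
Proof.
move=> t0; rewrite mulr_ge0 ?expR_ge0 //.
apply: egf_ge0 => // [|k]; first exact: kernel_pow_bounded.
rewrite -colE mxE; elim: k ord0 => [|k IH] y; first by rewrite mxE ler0n.
by rewrite exprS mxE sumr_ge0 // => z _; rewrite mulr_ge0 ?kernel_ge0.
Qed.

Lemma semigroup_at0_delta_le1 x t :
  0 <= t -> semigroup_at0 (delta_mx x 0) t <= 1.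
Proof.
move=> t0; rewrite -(semigroup_at0_const1 t).
have -> : const_mx 1 = \sum_y delta_mx y 0 :> 'cV[R]_m.+1.
  apply/colP => y; rewrite summxE mxE (bigD1 y) //= mxE !eqxx big1 ?addr0 //.
  by move=> z zy; rewrite mxE eq_sym (negPf zy).
rewrite semigroup_at0_sum (bigD1 x) //= lerDl sumr_ge0 // => y _.
exact: semigroup_at0_delta_ge0.
Qed.

(** For B = 0 this says that I + K preserves decreasing functions: the chain
    moves by at most one, so (K g) x >= g (x+1) and (K g) (x+1) <= g x, and the
    summand I of I + K supplies the other halves g x and g (x+1).  The slack B
    is what makes the differential inequality below iterable. *)
Lemma lazy_kernel_monotone (g : 'I_m.+1 -> R) (B : R) : 0 <= B ->
  (forall x y : 'I_m.+1, y = x.+1 :> nat -> g y - B <= g x) ->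
  forall x y : 'I_m.+1, y = x.+1 :> nat ->
    (g y + \sum_z K y z * g z) - 4 * B <= g x + \sum_z K x z * g z.
Proof.
move=> B0 gB x y yx; have gxy := gB _ _ yx.
have lo : g y - 2 * B <= \sum_z K x z * g z.
  rewrite -[leLHS]mul1r -[X in X * _](kernel_sum1 x) mulr_suml.
  apply: ler_sum => z _.
  case: (ltngtP z x) => [zx|xz|/val_inj ->].
  - move: (zx); rewrite leq_eqVlt => /predU1P[zx1|zx1].
      by rewrite ler_wpM2l ?kernel_ge0 //; have := gB _ _ (esym zx1); lra.
    by rewrite kernel_eq0 ?zx1 ?orbT // !mul0r.
  - move: (xz); rewrite leq_eqVlt => /predU1P[xz1|xz1].
      have <- : y = z by apply: val_inj; rewrite /= yx.
      by rewrite ler_wpM2l ?kernel_ge0 //; lra.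
    by rewrite kernel_eq0 ?xz1 // !mul0r.
  - by rewrite ler_wpM2l ?kernel_ge0 //; lra.
have hi : \sum_z K y z * g z <= g x + 2 * B.
  rewrite -[leRHS]mul1r -[X in X * _](kernel_sum1 y) mulr_suml.
  apply: ler_sum => z _.
  case: (ltngtP z y) => [zy|yz|/val_inj ->].
  - move: (zy); rewrite leq_eqVlt => /predU1P[zy1|zy1].
      have -> : z = x by apply/val_inj/succn_inj; rewrite zy1.
      by rewrite ler_wpM2l ?kernel_ge0 //; lra.
    by rewrite kernel_eq0 ?zy1 ?orbT // !mul0r.
  - move: (yz); rewrite leq_eqVlt => /predU1P[yz1|yz1].
      by rewrite ler_wpM2l ?kernel_ge0 //; have := gB _ _ (esym yz1); lra.
    by rewrite kernel_eq0 ?yz1 // !mul0r.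
  - by rewrite ler_wpM2l ?kernel_ge0 //; lra.
lra.
Qed.

(** The value of gamma^t / nu at x is the semigroup applied to density x. *)
Definition density x : 'cV[R]_m.+1 := (nu 0 x)^-1 *: delta_mx x 0.

Lemma kernel_density x : K *m density x = \sum_y K x y *: density y.
Proof.
apply/colP => z; rewrite -scalemxAr -colE !mxE summxE (bigD1 z) //=.
rewrite big1 ?addr0 => [|y yz]; last first.
  by rewrite !mxE eq_sym (negPf yz) !mulr0.
have nx := lt0r_neq0 (nu_gt0 x); have nz := lt0r_neq0 (nu_gt0 z).
rewrite !mxE !eqxx mulr1 mulrC; apply/eqP; rewrite eqr_div //.
by rewrite mulrC detailed_balance mulrC.
Qed.

(** The functions W z = e^{2t} (e^{-tL} density z)(0) solve W' = (I + K) W and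
    are decreasing in z at time 0.  Starting from a crude bound, each
    integration of the differential inequality improves the defect of
    monotonicity from B (4s)^k / k! to B (4s)^(k+1) / (k+1)!, and this tends
    to 0. *)
Lemma semigroup_at0_density_homo (x y : 'I_m.+1) t : y = x.+1 :> nat ->
  0 <= t -> semigroup_at0 (density y) t <= semigroup_at0 (density x) t.
Proof.
move=> yx t0.
pose W z s := expR (2 * s) * semigroup_at0 (density z) s.
have WE z s : is_derive s (1 : R) (W z) (W z s + \sum_w K z w * W w s).
  have eE := is_derive_expRM 2 s.
  have fE := is_derive_semigroup_at0 (density z) s.
  have -> : W z = (fun s => expR (2 * s)) * semigroup_at0 (density z) by [].
  apply: is_derive_eq; rewrite /GRing.scale /=.
  rewrite mulmxBl mul1mx -[- (K *m _)]scaleN1r semigroup_at0D.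
  rewrite (semigroup_at0Z (-1)) kernel_density semigroup_at0_sum.
  have -> : \sum_w K z w * W w s =
      expR (2 * s) * \sum_w semigroup_at0 (K z w *: density w) s.
    rewrite mulr_sumr; apply: eq_bigr => w _.
    by rewrite (semigroup_at0Z (K z w)) mulrCA.
  by rewrite /W !fctE; ring.
pose B := expR (2 * t) * \sum_z (nu 0 z)^-1.
have B0 : 0 <= B.
  by rewrite mulr_ge0 ?expR_ge0 // sumr_ge0 // => z _; rewrite invr_ge0 nu_ge0.
have WB k s (z w : 'I_m.+1) : 0 <= s <= t -> w = z.+1 :> nat ->
    W w s - B * exp_coeff (4 * s) k <= W z s.
  elim: k s z w => [|k IH] s z w /andP[s0 st] wz.
    rewrite /exp_coeff /= expr0 divr1 mulr1.
    have : 0 <= W z s.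
      rewrite mulr_ge0 ?expR_ge0 // semigroup_at0Z.
      rewrite mulr_ge0 ?invr_ge0 ?nu_ge0 //.
      exact: semigroup_at0_delta_ge0.
    apply: le_trans; rewrite subr_le0 ler_pM ?expR_ge0 //.
    - rewrite semigroup_at0Z mulr_ge0 ?invr_ge0 ?nu_ge0 //.
      exact: semigroup_at0_delta_ge0.
    - by rewrite ler_expR ler_wpM2l.
    rewrite semigroup_at0Z (bigD1 w) //=.
    rewrite -[leLHS]addr0 lerD ?sumr_ge0 // => [|v _]; last first.
      by rewrite invr_ge0 nu_ge0.
    by rewrite ler_piMr ?invr_ge0 ?nu_ge0 ?semigroup_at0_delta_le1.
  (* Compare with time 0, where W z - W w is the density of delta_0 at z. *)
  pose D u := W z u - W w u + B * exp_coeff (4 * u) k.+1.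
  suff : D 0 <= D s.
    have -> : D 0 = W z 0 - W w 0.
      by rewrite /D /exp_coeff /= mulr0 expr0n mul0r mulr0 addr0.
    rewrite /W mulr0 expR0 !mul1r !semigroup_at00 !mxE.
    have -> : (ord0 == w) = false.
      by apply/eqP => w0; move: wz; rewrite -w0.
    rewrite /= mulr0 subr0; set d := (X in X <= _).
    have d0 : 0 <= d by rewrite mulr_ge0 ?invr_ge0 ?nu_ge0 // ler0n.
    by move=> /(le_trans d0); rewrite /D /W; lra.
  have DE u : is_derive u (1 : R) D ((W z u + \sum_v K z v * W v u) -
      (W w u + \sum_v K w v * W v u) + 4 * (B * exp_coeff (4 * u) k)).
    apply: is_derive_eq (is_deriveD (is_deriveB (WE z u) (WE w u))
      (is_deriveZ B (is_derive_exp_coeff 4 u k))) _.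
    by rewrite /GRing.scale /= mulrCA.
  apply: derive_ge0_le DE _ s0 => u /andP[u0 us].
  have us' : 0 <= u <= t by rewrite u0 (le_trans us).
  have := lazy_kernel_monotone (g := W^~ u) (B := B * exp_coeff (4 * u) k).
  move=> /(_ _ _ _ _ wz)/wrap[||]; last by lra.
  - by rewrite mulr_ge0 // exp_coeff_ge0 // mulr_ge0.
  - by move=> a b; exact: IH.
suff : W y t <= W x t by rewrite ler_pM2l ?expR_gt0.
have cv : W y t - B * exp_coeff (4 * t) k @[k --> \oo] --> W y t - B * 0.
  by apply: cvgB; [exact: cvg_cst | apply: cvgMr; exact: cvg_exp_coeff].
rewrite mulr0 subr0 in cv; apply: cvgr_to_le cv _.
by apply: nearW => k; apply: WB; rewrite ?t0 ?lexx.
Qed.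

(** The density is smallest at m, so the maximum defining the separation is
    attained there. *)
Lemma sep_semigroup t : 0 <= t ->
  sep (ct_law K t) nu = 1 - semigroup_at0 (spectral_fun m) t.
Proof.
move=> t0; rewrite spectral_fun_max -/(density ord_max).
have E x : 1 - ct_law K t 0 x / nu 0 x = 1 - semigroup_at0 (density x) t.
  by rewrite ct_lawE semigroup_at0Z mulrC.
have dle x : semigroup_at0 (density ord_max) t <= semigroup_at0 (density x) t.
  move: {2}(m - x)%N (erefl (m - x)%N) => k; elim: k x => [|k IH] x mx.
    rewrite (_ : x = ord_max) //; apply/val_inj/eqP; rewrite eqn_leq /=.
    by rewrite -ltnS ltn_ord /= -subn_eq0 mx.
  have xm : (x.+1 < m.+1)%N by rewrite ltnS -subn_gt0 mx.
  apply: (@le_trans _ _ (semigroup_at0 (density (Ordinal xm)) t)).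
    by apply: IH; rewrite /= subnS mx.
  exact: semigroup_at0_density_homo.
apply/eqP; rewrite eq_le /sep; apply/andP; split.
  apply/bigmax_leP; split=> [|x _]; by rewrite E lerD2l lerN2 dle.
by rewrite -E; exact: le_bigmax.
Qed.

Lemma lam1_le i : (i < m)%N -> lam 1%N <= lam i.+1.
Proof. by move=> im; case: lamE => lam_le _; apply: lam_le; rewrite ltnS. Qed.

End BirthDeathChain.

(** * Cut-off and hitting times of a separation profile *)

Section CutoffCriterion.
Variables (R : realType) (d : nat -> R -> R) (l T : nat -> R).

Local Notation N n := (l n * T n).

(** The profile d n plays the role of t |-> P(T_n > t), where T_n has mean
    T n and l n is the smallest of its rates. *)
Hypotheses (T_gt0 : forall n, 0 < T n) (N_ge1 : forall n, 1 <= N n)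
  (d_anti : forall n s t, 0 <= s -> s <= t -> d n t <= d n s)
  (d_ge_exp : forall n t, 0 <= t -> expR (- l n * t) <= d n t)
  (d_le1 : forall n t, 0 <= t -> d n t <= 1)
  (d_upper : forall n c, 0 < c ->
     d n ((1 + c) * T n) <= (1 + c ^+ 2 * N n)^-1)
  (d_lower : forall n c, 0 < c -> c <= 1 ->
     1 - (1 + c ^+ 2 * N n)^-1 <= d n ((1 - c) * T n)).

Lemma cantelli_bound_cvg0 (c e : R) : 0 < c -> 0 < e ->
  N n @[n --> \oo] --> +oo ->
  \forall n \near \oo, (1 + c ^+ 2 * N n)^-1 < e.
Proof.
move=> c0 e0 /cvgryPge/(_ (e^-1 / c ^+ 2)); apply: filterS => n.
rewrite ler_pdivrMr ?exprn_gt0 // mulrC => Ne.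
have e1 : 0 < e^-1 by rewrite invr_gt0.
by rewrite invf_plt ?posrE //; lra.
Qed.

Let d_ge0 n t : 0 <= t -> 0 <= d n t.
Proof. by move=> t0; apply: le_trans (d_ge_exp _ t0); exact: expR_ge0. Qed.

Definition cutoff_at (s : nat -> R) := forall eps : R, 0 < eps < 1 ->
  (forall u : nat -> R, (\forall n \near \oo, (1 + eps) * s n < u n) ->
     d n (u n) @[n --> \oo] --> (0 : R)) /\
  (forall u : nat -> R, (\forall n \near \oo, 0 <= u n < (1 - eps) * s n) ->
     d n (u n) @[n --> \oo] --> (1 : R)).

Lemma cutoff_at_of_cvgy : N n @[n --> \oo] --> +oo -> cutoff_at T.
Proof.
move=> Noo eps /andP[eps0 eps1]; split=> u uT; apply/cvgrPdist_lt => e e0.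
- near=> n; have uTn : (1 + eps) * T n < u n by near: n.
  have Nn : (1 + eps ^+ 2 * N n)^-1 < e.
    by near: n; exact: cantelli_bound_cvg0.
  have t0 : 0 <= (1 + eps) * T n by rewrite mulr_ge0 ?addr_ge0 // ltW.
  have := d_anti n t0 (ltW uTn); have := d_upper n eps0.
  have := d_ge0 n (le_trans t0 (ltW uTn)).
  by rewrite sub0r normrN => dn *; rewrite ger0_norm //; lra.
- near=> n; have /andP[u0 uTn] : 0 <= u n < (1 - eps) * T n by near: n.
  have Nn : (1 + eps ^+ 2 * N n)^-1 < e.
    by near: n; exact: cantelli_bound_cvg0.
  have := d_anti n u0 (ltW uTn); have := d_lower n eps0 (ltW eps1).
  have dn := d_le1 n u0; rewrite ger0_norm ?subr_ge0 //; lra.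
Unshelve. all: by end_near. Qed.

(** At time 2 s the profile tends to 0 and dominates exp(- 2 l s), so l s tends
    to infinity.  At times below s / 2 it tends to 1, while at 2 T it is at most
    1 / (1 + N) <= 1 / 2; hence s < 8 T eventually. *)
Lemma cvgy_of_cutoff_at s : (forall n, 0 < s n) -> cutoff_at s ->
  N n @[n --> \oo] --> +oo.
Proof.
move=> s0 cut; have l0 n : 0 < l n.
  by rewrite -(pmulr_lgt0 _ (T_gt0 n)) (lt_le_trans _ (N_ge1 n)).
have [|cut0 cut1] := cut 2^-1; first by apply/andP; split; lra.
have D0 : d n (2 * s n) @[n --> \oo] --> (0 : R).
  by apply: cut0; apply: nearW => n; have := s0 n; lra.
(* The minimum stays below s / 2 and can be compared with 2 T. *)
have D1 : d n (Num.min (2 * T n) (s n / 4)) @[n --> \oo] --> (1 : R).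
  apply: cut1; apply: nearW => n; have := s0 n => sn.
  rewrite le_min gt_min; have := T_gt0 n; lra.
apply/cvgryPge => A; near=> n.
have dA : `|0 - d n (2 * s n)| < expR (- (16 * A)).
  by near: n; move/cvgrPdist_lt: D0; apply; exact: expR_gt0.
have d1 : `|1 - d n (Num.min (2 * T n) (s n / 4))| < 2^-1.
  by near: n; move/cvgrPdist_lt: D1; apply; lra.
have sn := s0 n; have Tn := T_gt0 n; have ln := l0 n.
have lsA : 16 * A < l n * (2 * s n).
  rewrite -ltrN2 -mulNr -ltr_expR; apply: le_lt_trans dA.
  rewrite sub0r normrN; apply: le_trans (ler_norm _).
  by apply: d_ge_exp; lra.
have sT : s n / 4 < 2 * T n.
  rewrite ltNge; apply/negP => Ts; move: d1; rewrite min_l //.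
  have := d_upper n (ltr01 : 0 < 1 :> R); rewrite expr1n mul1r => dT.
  have N1 := N_ge1 n.
  have : (1 + N n)^-1 <= 2^-1 by rewrite lef_pV2 ?posrE; lra.
  by move=> ? /ltr_normlW; lra.
have : l n * s n <= l n * (8 * T n) by rewrite ler_pM2l //; lra.
lra.
Unshelve. all: by end_near. Qed.

Definition hitting n eps : R := inf [set t : R | 0 <= t /\ d n t <= eps].

(** The upper bound at c = 1 / eps, using N >= 1. *)
Lemma le_eps_late n eps : 0 < eps < 1 ->
  0 <= (1 + eps^-1) * T n /\ d n ((1 + eps^-1) * T n) <= eps.
Proof.
move=> /andP[e0 e1]; have ei : 0 < eps^-1 by rewrite invr_gt0.
split; first by rewrite mulr_ge0 ?addr_ge0 // ltW.
apply: le_trans (d_upper n ei) _.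
have ei1 : 1 <= eps^-1 by rewrite invf_ge1 // ltW.
have N1 := N_ge1 n.
by rewrite invf_ple ?posrE //; nra.
Qed.

Lemma hitting_le n eps : 0 < eps < 1 -> hitting n eps <= (1 + eps^-1) * T n.
Proof.
move=> e01; apply: ge_inf; last exact: le_eps_late.
by exists 0 => t [].
Qed.

Lemma hitting_ge n eps t : 0 < eps < 1 -> 0 <= t -> eps < d n t ->
  t <= hitting n eps.
Proof.
move=> e01 t0 dt; apply: lb_le_inf => [|s [s0 ds]].
  by exists ((1 + eps^-1) * T n); exact: le_eps_late.
rewrite leNgt; apply/negP => st; have := d_anti n s0 (ltW st); lra.
Qed.

Lemma hitting_cvgy eps : 0 < eps < 1 ->
  (N n @[n --> \oo] --> +oo <-> l n * hitting n eps @[n --> \oo] --> +oo).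
Proof.
move=> e01; have l0 n : 0 < l n.
  by rewrite -(pmulr_lgt0 _ (T_gt0 n)) (lt_le_trans _ (N_ge1 n)).
have [e0 e1] := andP e01; split=> Noo; apply/cvgryPge => A; near=> n.
- have hn : (1 + 2^-1 ^+ 2 * N n)^-1 < 1 - eps.
    by near: n; apply: cantelli_bound_cvg0 => //; lra.
  have N2 : 2 * A <= N n by near: n; move/cvgryPge: Noo; apply.
  have h0 : 0 < 2^-1 :> R by lra.
  have h1 : 2^-1 <= 1 :> R by lra.
  have dn := d_lower n h0 h1; have Tn := T_gt0 n.
  have : (1 - 2^-1) * T n <= hitting n eps.
    by apply: hitting_ge => //; [rewrite mulr_ge0 ?ltW // | ]; lra.
  rewrite -(ler_pM2l (l0 n)); lra.
- have hn : (1 + eps^-1) * A <= l n * hitting n eps.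
    by near: n; move/cvgryPge: Noo; apply.
  have ei : 0 < 1 + eps^-1 by rewrite addr_gt0 ?invr_gt0.
  rewrite -(ler_pM2l ei); apply: le_trans hn _.
  by rewrite mulrCA ler_pM2l // hitting_le.
Unshelve. all: by end_near. Qed.

End CutoffCriterion.

(** * Separation cut-off for birth and death chains *)

Theorem theorem5p1 (R : realType) (m : nat -> nat)
    (K : forall n, 'M[R]_((m n).+1)) (nu : forall n, 'rV[R]_(m n).+1)
    (lam : nat -> nat -> R)
    (m_ge1 : forall n, (1 <= m n)%N)
    (K_bd : forall n, is_birth_death (K n))
    (K_irr : forall n, bd_irreducible (K n))
    (nu_stat : forall n, is_stationary (K n) (nu n))
    (lam_eig : forall n, ordered_eigenvalues (1%:M - K n) (lam n)) :
  let gamma n (t : R) := ct_law (K n) t in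
  let tn n : R := \sum_(1 <= i < (m n).+1) (lam n i)^-1 in
  let N n : R := lam n 1%N * tn n in
  let tau n (eps : R) := sep_time (gamma n) (nu n) eps in
  [/\ has_sep_cutoff nu gamma <-> N n @[n --> \oo] --> +oo,
      forall n (c : R), 0 < c ->
        sep (gamma n ((1 + c) * tn n)) (nu n) <= (1 + c ^+ 2 * N n)^-1 /\
        (c <= 1 ->
         1 - (1 + c ^+ 2 * N n)^-1 <= sep (gamma n ((1 - c) * tn n)) (nu n))
    & forall eps : R, 0 < eps < 1 ->
        (lam n 1%N * tn n @[n --> \oo] --> +oo <->
         lam n 1%N * tau n eps @[n --> \oo] --> +oo)].
Proof.
move=> gamma tn N tau.
pose F n i := semigroup_at0 (K n) (spectral_fun (K n) (nu n) (lam n) i).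
have l0 n i : (i < m n)%N -> 0 < lam n i.+1 by exact: lam_gt0.
have l1 n i : (i < m n)%N -> lam n 1%N <= lam n i.+1 by exact: lam1_le.
have FE n : hypoexp (m n) (lam n) (F n) by exact: hypoexp_semigroup.
pose d n t := sep (gamma n t) (nu n).
have dE n t : 0 <= t -> d n t = 1 - F n (m n) t by exact: sep_semigroup.
have T0 n : 0 < tn n by exact: (hypoexp_mean_gt0 (l0 n)).
have upper n c : 0 < c -> d n ((1 + c) * tn n) <= (1 + c ^+ 2 * N n)^-1.
  move=> c0; rewrite dE; last by rewrite mulr_ge0 ?addr_ge0 // ltW.
  exact: (hypoexp_cantelli_upper (l0 n) (FE n) (m_ge1 n) c0 (l1 n)).
have lower n c : 0 < c -> c <= 1 ->
    1 - (1 + c ^+ 2 * N n)^-1 <= d n ((1 - c) * tn n).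
  move=> c0 c1; rewrite dE; last by rewrite mulr_ge0 ?subr_ge0 // ltW.
  rewrite lerD2l lerN2.
  exact: (hypoexp_cantelli_lower (l0 n) (FE n) (m_ge1 n) c0 c1 (l1 n)).
have N1 n : 1 <= N n.
  rewrite /N /tn big_ltn ?ltnS ?m_ge1 // mulrDr mulfV ?lerDl ?gt_eqF ?l0 //.
  apply: mulr_ge0; first exact/ltW/l0.
  rewrite big_nat_cond sumr_ge0 // => -[|i] //.
  by rewrite andbT ltnS => /andP[_ im]; rewrite invr_ge0 ltW ?l0.
have anti n s t : 0 <= s -> s <= t -> d n t <= d n s.
  move=> s0 st; rewrite !dE ?(le_trans s0) // lerD2l lerN2.
  exact: (hypoexp_homo (l0 n) (FE n)).
have dexp n t : 0 <= t -> expR (- lam n 1%N * t) <= d n t.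
  move=> t0; rewrite dE // lerBrDl -lerBrDr -{1}(prednK (m_ge1 n)).
  by apply: (hypoexp_le_exp (l0 n) (FE n)) => //; rewrite prednK.
have dle1 n t : 0 <= t -> d n t <= 1.
  by move=> t0; rewrite dE // gerBl (hypoexp_ge0 (l0 n) (FE n)).
split; first split.
- move=> [s [s0 cut]]; exact: (cvgy_of_cutoff_at T0 N1 dexp upper s0 cut).
- move=> Noo; exists tn; split=> //.
  exact: (cutoff_at_of_cvgy T0 anti dexp dle1 upper lower Noo).
- by move=> n c c0; split; [exact: upper | exact: lower].
- by move=> eps; exact: (hitting_cvgy T0 N1 anti upper lower).
Qed.
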